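(* With polynomials $x$ restricted to $\deg(x)\le 3$, the number $\delta=\frac{\sqrt{2+\sqrt{2}}}{2}$ is quasi-admissible and every real $\delta<\frac{\sqrt{2+\sqrt{2}}}{2}$ is admissible. That is, $\frac{\sqrt{2+\sqrt{2}}}{2}$ is quasi-admissible by some $x,y$ with $\deg(x)\le 3$, and every real $\delta<\frac{\sqrt{2+\sqrt{2}}}{2}$ is admissible by some $x,y$ with $\deg(x)\le 3$.
   Context: A polynomial $p(s)\in\mathbb{R}[s]$ is stable if every complex root $t$ of $p$ satisfies $\mathrm{Re}(t)<0$, and quasi-stable if every complex root $t$ of $p$ satisfies $\mathrm{Re}(t)\le 0$. (Nonzero constants are stable; the zero polynomial is neither stable nor quasi-stable.) Let $H$ be the set of stable polynomials in $\mathbb{R}[s]$ and $\overline{H}$ the set of quasi-stable polynomials in $\mathbb{R}[s]$. A real number $\delta$ is admissible by $x,y$ if $x,y\in H$, $\deg(x)\ge\deg(y)$, and $(s^2-2\delta s+1)x(s)+(s^2-1)y(s)\in H$. A real number $\delta$ is quasi-admissible by $x,y$ if $x,y\in\overline{H}$, $\deg(x)\ge\deg(y)$, and $(s^2-2\delta s+1)x(s)+(s^2-1)y(s)\in\overline{H}$. *)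

(* Defs.v *)
From mathcomp Require Import all_boot all_order all_algebra.
From mathcomp Require Import reals complex.
Set Implicit Arguments.
Unset Strict Implicit.
Unset Printing Implicit Defensive.
Import GRing.Theory Num.Theory.
Local Open Scope ring_scope.

(* The zero polynomial is neither stable nor quasi-stable: every t : R[i] is a
   root of it, in particular t = 1. *)
Definition stable (R : realType) (p : {poly R}) : Prop :=
  forall t : R[i], root (map_poly (real_complex R) p) t -> complex.Re t < 0.

Definition quasi_stable (R : realType) (p : {poly R}) : Prop :=
  forall t : R[i], root (map_poly (real_complex R) p) t -> complex.Re t <= 0.

Definition closed_loop (R : realType) (delta : R) (x y : {poly R}) : {poly R} :=
  ('X^2 - (2 * delta) *: 'X + 1) * x + ('X^2 - 1) * y.

(* [size p] is the degree plus one for p != 0, so [size y <= size x] is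
   deg x >= deg y: stability and quasi-stability exclude zero polynomials. *)
Definition admissible_by (R : realType) (delta : R) (x y : {poly R}) : Prop :=
  [/\ stable x, stable y, (size y <= size x)%N
    & stable (closed_loop delta x y)].

Definition quasi_admissible_by (R : realType) (delta : R) (x y : {poly R})
    : Prop :=
  [/\ quasi_stable x, quasi_stable y, (size y <= size x)%N
    & quasi_stable (closed_loop delta x y)].

(* Main.v *)
Require Import Defs.
From mathcomp Require Import all_boot all_order all_algebra.
From mathcomp Require Import reals complex.
From mathcomp Require Import ring lra.
Import Order.TTheory GRing.Theory Num.Theory.
Local Open Scope ring_scope.

(** Let [y] be a constant [c > 0]. If [theta] is the angle with
    [cos theta = delta], then [s^2 - 2 delta s + 1] vanishes at
    [e^(i theta)], so a monic real quintic [z] is a closed loop for some cubic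
    [x] exactly when [z - c (s^2 - 1)] vanishes there. Since
    [e^(2 i theta) - 1 = 2 i sin theta e^(i theta)], some [c > 0] achieves
    this exactly when [z(e^(i theta))] has argument [pi/2 + theta]. For
    [z = s^5] the condition is [5 theta = pi/2 + theta], that is
    [theta = pi/8], and [cos (pi/8) = sqrt (2 + sqrt 2) / 2]: this is the
    quasi-admissible value.

    For a smaller [delta], hence a larger [theta], adding a positive [e] to
    [e^(i theta)] decreases its argument, and [z = (s + e)^5] meets the
    condition for a suitable [e]. Put algebraically, the condition is that [e]
    is a root of [phase_poly delta], and the intermediate value theorem gives
    a root in [[0, 1]] when [1/2 < delta]: at [e = 1] the argument of
    [1 + e^(i theta)] is [theta / 2], and
    [5 theta / 2 <= pi/2 + theta] exactly when [delta >= 1/2]. The quotient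
    [x] is then stable by the Routh-Hurwitz criterion for cubics. The values
    [delta <= 1/2] are all served by one pair, [x = s + 3/4] and [y = 2/3],
    whose closed loop is a cubic under the same criterion. *)

(** * Stability of polynomials of low degree *)

Section Stability.
Variable R : realType.
Implicit Types (p : {poly R}) (a b c e : R).

Definition cubic a b c : {poly R} := 'X^3 + a *: 'X^2 + b *: 'X + c%:P.

Lemma stable_quasi_stable p : stable p -> quasi_stable p.
Proof. by move=> sp t /sp /ltW. Qed.

Lemma stable_neq0 p : stable p -> p != 0.
Proof.
move=> sp; apply/eqP => p0; have := sp 1.
by rewrite p0 rmorph0 root0 => /(_ isT); rewrite /= ltNge ler01.
Qed.

Lemma stableC c : c != 0 -> stable c%:P.
Proof. by move=> c0 t; rewrite map_polyC rootC fmorph_eq0 (negPf c0). Qed.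

Lemma root_map_XaddC_exp e n (t : R[i]) :
  root (map_poly (real_complex R) (('X + e%:P) ^+ n.+1)) t ->
  complex.Re t = - e.
Proof.
rewrite rmorphXn rmorphD /= map_polyX map_polyC /root !hornerE.
rewrite expf_eq0 /= => /eqP te.
case: t te => u v; rewrite -[real_complex R e]/(Complex e 0) => -[ue _].
by apply/eqP; rewrite -addr_eq0; apply/eqP.
Qed.

Lemma stable_XaddC a : 0 < a -> stable ('X + a%:P).
Proof.
by move=> a0 t; rewrite -['X + _]expr1 => /root_map_XaddC_exp ->; rewrite oppr_lt0.
Qed.

(** Routh-Hurwitz in degree 3. For a root [u + i v] with [v != 0] the
    imaginary part gives [v^2 = 3 u^2 + 2 a u + b]; substituted in the real
    part, this leaves a cubic equation in [u] whose coefficients are all positive,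
    which excludes [u >= 0]. *)
Lemma stable_cubic a b c :
  0 < a -> 0 < b -> 0 < c -> c < a * b -> stable (cubic a b c).
Proof.
move=> a0 b0 c0 cab [u v] /=.
rewrite /cubic !rmorphD /= !linearZ /= !map_polyXn map_polyX map_polyC /root.
rewrite !hornerE /= -[real_complex R a]/(Complex a 0)
  -[real_complex R b]/(Complex b 0) -[real_complex R c]/(Complex c 0).
rewrite !exprS !expr0 !mulr1 => /eqP [re im]; rewrite ltNge; apply/negP => u0.
have u2 : 0 <= u ^+ 2 by rewrite sqr_ge0.
have u3 : 0 <= u ^+ 3 by rewrite exprn_ge0.
have au : 0 <= a * u by rewrite mulr_ge0 // ltW.
have au2 : 0 <= a * u ^+ 2 by rewrite mulr_ge0 // ltW.
have bu : 0 <= b * u by rewrite mulr_ge0 // ltW.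
have aau : 0 <= a * (a * u) by rewrite mulr_ge0 // ltW.
have re' : u ^+ 3 - 3 * u * v ^+ 2 + a * (u ^+ 2 - v ^+ 2) + b * u + c = 0.
  by rewrite -re; ring.
have : v * (3 * u ^+ 2 - v ^+ 2 + 2 * a * u + b) = 0 by rewrite -im; ring.
move=> /eqP; rewrite mulf_eq0 => /orP[/eqP v0 | /eqP vE].
  by move: re'; rewrite v0; lra.
have v2 : v ^+ 2 = 3 * u ^+ 2 + 2 * a * u + b by lra.
have : 8 * u ^+ 3 + 8 * (a * u ^+ 2) + 2 * (b * u) + 2 * (a * (a * u))
       + (a * b - c) = 0.
  by apply/eqP; rewrite -oppr_eq0 -[0]re' v2; apply/eqP; ring.
lra.
Qed.

End Stability.

Arguments cubic {R}.

(** * Placing the closed loop at a quintuple pole *)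

Section QuintuplePole.
Variable R : realType.
Implicit Types (delta e : R).

(** With [delta = cos theta], the value at [e] is minus the real part of
    [(e^(i theta) + e)^5 / e^(i theta)]. *)
Definition phase_poly delta : {poly R} :=
  Poly [:: - 8 * delta ^+ 4 + 8 * delta ^+ 2 - 1;
           15 * delta - 20 * delta ^+ 3;
           10 * (1 - 2 * delta ^+ 2);
           - 10 * delta; - 5; - delta].

Lemma horner_phase_poly delta e :
  (phase_poly delta).[e] =
  - delta * e ^+ 5 - 5 * e ^+ 4 - 10 * delta * e ^+ 3
  + 10 * (1 - 2 * delta ^+ 2) * e ^+ 2 + (15 * delta - 20 * delta ^+ 3) * e
  + (- 8 * delta ^+ 4 + 8 * delta ^+ 2 - 1).
Proof. by rewrite horner_Poly /=; ring. Qed.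

(** Comparing the coefficients of [s^4], [s^3], [s^2] and [1] in the closed
    loop with those of [(s + e)^5] determines [x] and [y = c]; the remaining
    coefficient, that of [s], is the equation [phase_poly delta] at [e]. *)
Lemma quintuple_pole_design delta e :
  1 / 2 < delta -> 0 <= e <= 1 -> root (phase_poly delta) e ->
  exists x y : {poly R}, [/\ (size x <= 4)%N, stable x, stable y,
    (size y <= size x)%N & closed_loop delta x y = ('X + e%:P) ^+ 5].
Proof.
move=> d12 /andP[e0 e1] /rootP; rewrite horner_phase_poly => phase.
pose a := 5 * e + 2 * delta.
pose b := 10 * e ^+ 2 + 2 * delta * a - 1.
pose c := (10 * e ^+ 3 - e ^+ 5 + 2 * delta * b - a) / 2.
pose d := c + e ^+ 5.
have cE : 2 * delta * c = b - 5 * e ^+ 4 - 2 * delta * e ^+ 5.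
  by apply/eqP; rewrite -subr_eq0 -[0]oppr0 -[in - 0]phase /c /b /a;
     apply/eqP; field.
have bd : b = 5 * e ^+ 4 + 2 * delta * d by rewrite /d mulrDr cE; ring.
have d0 : 0 < delta by lra.
have e2 : 0 <= e ^+ 2 by rewrite sqr_ge0.
have e3 : 0 <= e ^+ 3 by rewrite exprn_ge0.
have e4 : 0 <= e ^+ 4 by rewrite exprn_ge0.
have e5 : 0 <= e ^+ 5 by rewrite exprn_ge0.
have de : 0 <= delta * e by rewrite mulr_ge0 // ltW.
have dd : 1 / 4 < delta ^+ 2 by nra.
have e42 : e ^+ 4 <= e ^+ 2 by rewrite ler_wiXn2l.
have de51 : delta * e ^+ 5 <= delta * e.
  by rewrite ler_wpM2l ?(ltW d0) // -[leRHS]expr1 ler_wiXn2l.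
have c0 : 0 < c.
  (* Since [e <= 1], [2 delta c] is at least
     [5 e^2 + 8 delta e + 4 delta^2 - 1]. *)
  have : 0 < 2 * delta * c by rewrite cE /b /a; lra.
  by rewrite pmulr_rgt0 // mulr_gt0.
have d0' : 0 < d by rewrite /d; lra.
have a0 : 0 < a by rewrite /a; lra.
have dd0 : 0 < delta * d by rewrite mulr_gt0.
have b0 : 0 < b by lra.
have dab : d < a * b.
  have db0 : 0 < delta * b by rewrite mulr_gt0.
  have eb0 : 0 <= e * b by rewrite mulr_ge0 // ltW.
  (* [2 (a b - d)] is [10 e b + 2 delta b + a - 10 e^3 - e^5]; the formula
     for [b] in terms of [d] controls [e^5], the one in terms of [a] controls
     [e^3]. *)
  have eb5 : 5 * e ^+ 5 <= e * b.
    have edd : 0 <= e * (delta * d) by rewrite mulr_ge0 // ltW.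
    by rewrite bd; lra.
  have eb3 : 10 * e ^+ 3 - e <= e * b.
    have eda : 0 <= e * (delta * a) by rewrite !mulr_ge0 // ltW.
    by rewrite /b; lra.
  have -> : d = (10 * e ^+ 3 + e ^+ 5 + 2 * (delta * b) - a) / 2.
    by rewrite /d /c; field.
  have -> : a * b = 5 * (e * b) + 2 * (delta * b) by rewrite /a; ring.
  by rewrite /a; lra.
have sx : stable (cubic a b d) by apply: stable_cubic.
exists (cubic a b d), c%:P; split=> //.
- rewrite /cubic -addrA -addrA size_polyDl ?size_polyXn //.
  rewrite (leq_ltn_trans (size_polyD _ _)) // gtn_max.
  rewrite (leq_ltn_trans (size_scale_leq _ _)) ?size_polyXn //=.
  rewrite (leq_ltn_trans (size_polyD _ _)) // gtn_max.
  rewrite (leq_ltn_trans (size_scale_leq _ _)) ?size_polyX //=.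
  by rewrite (leq_ltn_trans (size_polyC_leq1 _)).
- by apply: stableC; rewrite gt_eqF.
- by rewrite (leq_trans (size_polyC_leq1 _)) // size_poly_gt0 stable_neq0.
have -> : closed_loop delta (cubic a b d) c%:P =
    'X^5 + (a - 2 * delta)%:P * 'X^4 + (b - 2 * delta * a + 1)%:P * 'X^3
    + (d - 2 * delta * b + a + c)%:P * 'X^2 + (b - 2 * delta * d)%:P * 'X
    + (d - c)%:P.
  by rewrite /closed_loop /cubic -!mul_polyC; ring.
have -> : a - 2 * delta = 5 * e by rewrite /a; ring.
have -> : b - 2 * delta * a + 1 = 10 * e ^+ 2 by rewrite /b; ring.
have -> : d - 2 * delta * b + a + c = 10 * e ^+ 3 by rewrite /d /c; field.
have -> : b - 2 * delta * d = 5 * e ^+ 4 by rewrite {1}bd; ring.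
have -> : d - c = e ^+ 5 by rewrite /d; ring.
by ring.
Qed.

End QuintuplePole.

Arguments phase_poly {R}.

(** * The critical value *)

Section CriticalValue.
Variable R : realType.
Implicit Types delta : R.

Definition critical : R := Num.sqrt (2 + Num.sqrt 2) / 2.

Lemma critical_sqr : critical ^+ 2 = (2 + Num.sqrt 2) / 4.
Proof.
rewrite /critical expr_div_n sqr_sqrtr ?addr_ge0 ?sqrtr_ge0 //.
by field.
Qed.

Lemma critical_sqr_gt : 3 / 4 < critical ^+ 2.
Proof.
have : (1 : R) < Num.sqrt 2 by rewrite -[ltLHS]sqrtr1 ltr_sqrt //; lra.
by rewrite critical_sqr; lra.
Qed.

Lemma critical_gt_half : 1 / 2 < critical.
Proof.
have c0 : 0 <= critical by rewrite divr_ge0 ?sqrtr_ge0.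
by have := critical_sqr_gt; nra.
Qed.

(** At [0] the phase polynomial takes the value [- cos (4 theta)], which
    vanishes when [theta = pi/8]. *)
Lemma phase_poly_critical : root (phase_poly critical) 0.
Proof.
have r2 : (Num.sqrt 2 : R) ^+ 2 = 2 by rewrite sqr_sqrtr.
apply/rootP; rewrite horner_phase_poly -[4%N]/(2 * 2)%N !exprM critical_sqr.
by field: r2.
Qed.

Lemma phase_poly0_gt0 delta :
  1 / 2 < delta -> delta < critical -> 0 < (phase_poly delta).[0].
Proof.
move=> d12 dc; have c34 := critical_sqr_gt.
have ds : delta ^+ 2 < critical ^+ 2 by rewrite ltr_pXn2r ?nnegrE //; lra.
have dd : 1 / 4 < delta ^+ 2 by nra.
(* Subtracting the zero value at [critical] exposes a factorisation. *)
have -> : (phase_poly delta).[0] =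
    8 * ((critical ^+ 2 - delta ^+ 2) * (critical ^+ 2 + delta ^+ 2 - 1)).
  have /rootP := phase_poly_critical; rewrite !horner_phase_poly => cE.
  by rewrite -[LHS]subr0 -[X in _ - X]cE; ring.
by rewrite !mulr_gt0 //; lra.
Qed.

(** One pair suffices because the two middle coefficients of the closed loop
    decrease with [delta], so that the Routh-Hurwitz conditions only have to
    hold at [delta = 1/2], where they read [1/12 < 5/12 * 1/4]. *)
Lemma admissible_le_half delta : delta <= 1 / 2 ->
  admissible_by delta ('X + (3 / 4)%:P) (2 / 3)%:P.
Proof.
move=> d12; split.
- by apply: stable_XaddC; rewrite divr_gt0.
- by apply: stableC; rewrite gt_eqF // divr_gt0.
- by rewrite size_XaddC (leq_trans (size_polyC_leq1 _)).
have -> : closed_loop delta ('X + (3 / 4)%:P) (2 / 3)%:P =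
          cubic (17 / 12 - 2 * delta) (1 - 3 / 2 * delta) (1 / 12).
  rewrite /closed_loop /cubic -!mul_polyC.
  have -> : 17 / 12 - 2 * delta = 3 / 4 + 2 / 3 - 2 * delta by field.
  have -> : 1 - 3 / 2 * delta = 1 - 3 / 4 * (2 * delta) by field.
  have -> : 1 / 12 = 3 / 4 - 2 / 3 :> R by field.
  by move: (3 / 4) (2 / 3) => a c; ring.
by apply: stable_cubic; nra.
Qed.

Lemma admissible_gt_half delta : 1 / 2 < delta -> delta < critical ->
  exists x y : {poly R}, (size x <= 4)%N /\ admissible_by delta x y.
Proof.
move=> d12 dc; have p0 := phase_poly0_gt0 _ d12 dc.
have p1 : (phase_poly delta).[1] < 0.
  have -> : (phase_poly delta).[1] =
    - (2 * delta - 1) * (4 * delta ^+ 3 + 12 * delta ^+ 2 + 12 * delta + 4).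
    by rewrite horner_phase_poly; ring.
  have d2 : 0 < delta ^+ 2 by rewrite exprn_gt0 //; lra.
  have d3 : 0 < delta ^+ 3 by rewrite exprn_gt0 //; lra.
  by rewrite mulNr oppr_lt0 mulr_gt0 //; lra.
have [e e01 re] : exists2 e, 0 <= e <= 1 & root (- phase_poly delta) e.
  by apply: poly_ivt; rewrite ?hornerN ?ler01 // oppr_le0 oppr_ge0 !ltW.
rewrite rootN in re.
have [x [y [sz sx sy yx cl]]] := quintuple_pole_design _ _ _ d12 e01 re.
exists x, y; split=> //; split=> //; rewrite cl => t /root_map_XaddC_exp ->.
rewrite oppr_lt0 lt_neqAle (andP e01).1 andbT.
by apply: contraTneq re => <-; rewrite /root gt_eqF.
Qed.

End CriticalValue.

Theorem theorem4p1 (R : realType) :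
  (exists x y : {poly R},
     (size x <= 4)%N /\
     quasi_admissible_by (Num.sqrt (2 + Num.sqrt 2) / 2) x y) /\
  (forall delta : R, delta < Num.sqrt (2 + Num.sqrt 2) / 2 ->
     exists x y : {poly R},
       (size x <= 4)%N /\ admissible_by delta x y).
Proof.
rewrite -/(critical R); split.
  have e01 : (0 : R) <= 0 <= (1 : R) by rewrite lexx ler01.
  have [x [y [sz sx sy yx cl]]] :=
    quintuple_pole_design _ _ _ (critical_gt_half R) e01 (phase_poly_critical R).
  exists x, y; split=> //; split=> //; try exact: stable_quasi_stable.
  by rewrite cl => t /root_map_XaddC_exp ->; rewrite oppr0.
move=> delta dc; have [d12|d12] := leP delta (1 / 2).
  exists ('X + (3 / 4)%:P), (2 / 3)%:P; split; last exact: admissible_le_half.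
  by rewrite size_XaddC.
exact: admissible_gt_half.
Qed.
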